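(* The real function $$f(x) := \frac{\pi}{4} - \frac{1}{2}\arcsin(1 - x) - \frac{1}{2}(1 - x)\sqrt{2x - x^2} - \frac{2x}{3\sqrt{5}}\sqrt{10x - 3x^2}$$ satisfies $f(x) < 0$ for all $0 < x \leq 1$. *)

(* Defs.v *)
From Stdlib Require Import Reals.
Open Scope R_scope.

(* [asin] and [sqrt] are total in Stdlib; for 0 <= x <= 2 (hence for 0 < x <= 1)
   the arguments below lie in their usual domains [-1, 1] and [0, +oo[.
   Not named [f], which would clash with a field of [Rtopology.family]. *)
Definition f_real (x : R) : R :=
  PI / 4 - 1 / 2 * asin (1 - x) - 1 / 2 * (1 - x) * sqrt (2 * x - x ^ 2)
  - 2 * x / (3 * sqrt 5) * sqrt (10 * x - 3 * x ^ 2).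

(* Main.v *)
Require Import Defs.
From Stdlib Require Import Reals Lra.
From Coquelicot Require Import Coquelicot.
Open Scope R_scope.

(** Substitute [x = 1 - cos t] with [0 < t <= PI / 2]: then [asin (1 - x)] becomes
    [PI / 2 - t] and [f] becomes a function of [t] that vanishes at [0].  Its derivative
    is [sin t] times [sqrt (2 x - x^2) - 2 (5 x - 2 x^2) / (sqrt 5 * sqrt (10 x - 3 x^2))],
    which is negative because, after squaring, the inequality to prove reduces to
    [5 (2 - x) (10 - 3 x) < 4 (5 - 2 x)^2], whose two sides differ by [x^2]. *)

Definition f_angle (t : R) : R :=
  t / 2 - sin t * cos t / 2
  - 2 * (1 - cos t) / (3 * sqrt 5)
    * sqrt (10 * (1 - cos t) - 3 * (1 - cos t) ^ 2).

Definition f_angle_deriv (t : R) : R :=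
  sin t * (sin t - 2 * (5 * (1 - cos t) - 2 * (1 - cos t) ^ 2)
           / (sqrt 5 * sqrt (10 * (1 - cos t) - 3 * (1 - cos t) ^ 2))).

Lemma slope_lt (s x : R) : 0 <= s -> s ^ 2 = 2 * x - x ^ 2 -> 0 < x <= 1 ->
  s < 2 * (5 * x - 2 * x ^ 2) / (sqrt 5 * sqrt (10 * x - 3 * x ^ 2)).
Proof.
intros Hs Hs2 Hx.
assert (H5 : 0 < sqrt 5) by (apply sqrt_lt_R0; lra).
assert (Hr : 0 < sqrt (10 * x - 3 * x ^ 2)) by (apply sqrt_lt_R0; nra).
assert (Q5 : sqrt 5 ^ 2 = 5) by (apply pow2_sqrt; lra).
assert (Qr : sqrt (10 * x - 3 * x ^ 2) ^ 2 = 10 * x - 3 * x ^ 2)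
  by (apply pow2_sqrt; nra).
assert (Hp : 0 < sqrt 5 * sqrt (10 * x - 3 * x ^ 2)) by now apply Rmult_lt_0_compat.
apply Rlt_div_r; [exact Hp|].
apply Rsqr_incrst_0; [|nra|nra].
rewrite !Rsqr_pow2, !Rpow_mult_distr, Hs2, Q5, Qr.
(* After squaring, the right-hand side exceeds the left by exactly [x ^ 4]. *)
assert (0 < x ^ 4) by (apply pow_lt; lra).
nra.
Qed.

Lemma radicand_pos (t : R) : 0 < 1 - cos t <= 1 ->
  0 < 10 * (1 - cos t) - 3 * (1 - cos t) ^ 2.
Proof. nra. Qed.

Lemma one_sub_cos_bounds (t : R) : 0 < t <= PI / 2 -> 0 < 1 - cos t <= 1.
Proof.
intros Ht; split.
- assert (cos t < cos 0) by (apply cos_decreasing_1; lra).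
  rewrite cos_0 in *; lra.
- assert (0 <= cos t) by (apply cos_ge_0; lra); lra.
Qed.

Lemma is_derive_f_angle (t : R) : 0 < t <= PI / 2 ->
  is_derive f_angle t (f_angle_deriv t).
Proof.
intros Ht.
pose proof (radicand_pos t (one_sub_cos_bounds t Ht)) as Hr.
assert (H5 : 0 < sqrt 5) by (apply sqrt_lt_R0; lra).
unfold f_angle, f_angle_deriv.
auto_derive; [lra|].
replace (10 * (1 + - cos t) + - (3 * ((1 + - cos t) * ((1 + - cos t) * 1))))
  with (10 * (1 - cos t) - 3 * (1 - cos t) ^ 2) by ring.
assert (Hs : 0 < sqrt (10 * (1 - cos t) - 3 * (1 - cos t) ^ 2))
  by now apply sqrt_lt_R0.
assert (Qr := pow2_sqrt _ (Rlt_le _ _ Hr)).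
set (r := sqrt (10 * (1 - cos t) - 3 * (1 - cos t) ^ 2)) in *.
assert (HT := sin2_cos2 t); unfold Rsqr in HT.
apply Rminus_diag_uniq.
(* The computed derivative and the claimed one differ by a combination of the relations
   [sin^2 + cos^2 = 1] and [r ^ 2 = 10 x - 3 x^2] with [x = 1 - cos t]; written this way, both terms
   vanish. *)
transitivity ((1 - (sin t * sin t + cos t * cos t)) / 2
  - 2 * sin t / (3 * sqrt 5 * r)
    * (r ^ 2 - (10 * (1 - cos t) - 3 * (1 - cos t) ^ 2))).
- field; lra.
- rewrite HT, Qr; field; lra.
Qed.

(** At [t = 0] the radicand vanishes and the chain rule fails for [sqrt], so continuity on the
    closed interval needs its own proof. *)
Lemma continuity_pt_f_angle (t : R) : 0 <= t <= PI / 2 -> continuity_pt f_angle t.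
Proof.
intros Ht.
assert (Hr : 0 <= 10 * (1 - cos t) - 3 * (1 - cos t) ^ 2).
{ assert (0 <= cos t) by (apply cos_ge_0; lra).
  pose proof (COS_bound t); nra. }
unfold f_angle.
apply continuity_pt_minus; [reg|].
apply continuity_pt_mult; [reg|].
apply (continuity_pt_comp (fun t => 10 * (1 - cos t) - 3 * (1 - cos t) ^ 2) sqrt);
  [reg|now apply continuity_pt_sqrt].
Qed.

Lemma f_angle_0 : f_angle 0 = 0.
Proof.
unfold f_angle; rewrite sin_0, cos_0, Rminus_diag; unfold Rdiv; ring.
Qed.

Lemma f_angle_deriv_neg (t : R) : 0 < t <= PI / 2 -> f_angle_deriv t < 0.
Proof.
intros Ht.
pose proof PI_RGT_0 as Hpi.
assert (Hsin : 0 < sin t) by (apply sin_gt_0; lra).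
assert (HT := sin2_cos2 t); unfold Rsqr in HT.
(* For [x = 1 - cos t], the relation [s ^ 2 = 2 x - x ^ 2] with [s = sin t] is the Pythagorean
   identity. *)
assert (Hslope := slope_lt (sin t) (1 - cos t) (Rlt_le _ _ Hsin)
  ltac:(nra) (one_sub_cos_bounds t Ht)).
unfold f_angle_deriv; nra.
Qed.

Lemma f_angle_neg (t : R) : 0 < t <= PI / 2 -> f_angle t < 0.
Proof.
intros Ht.
assert (Hder : forall u, 0 < u < t -> derivable_pt_lim f_angle u (f_angle_deriv u))
  by (intros u Hu; apply is_derive_Reals, is_derive_f_angle; lra).
(* Stdlib's [MVT] is used because [f_angle_deriv 0 = 0]: the intermediate point
   must lie in the open interval. *)
destruct (MVT f_angle id 0 t
  (fun u Hu => exist _ (f_angle_deriv u) (Hder u Hu))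
  (fun u _ => derivable_pt_id u)) as [c [Hc Hmvt]].
- lra.
- intros u Hu; apply continuity_pt_f_angle; lra.
- intros u _; apply derivable_continuous_pt, derivable_pt_id.
(* With [id] as second function, [Hmvt] becomes [f_angle t = t * f_angle_deriv c], up to trivial
   terms. *)
- rewrite derive_pt_id, f_angle_0 in Hmvt; unfold id in Hmvt; simpl in Hmvt.
  assert (Hneg : f_angle_deriv c < 0) by (apply f_angle_deriv_neg; lra).
  nra.
Qed.

Theorem lemmaB1 (x : R) (hx : 0 < x <= 1) : f_real x < 0.
Proof.
assert (Hcos : cos (acos (1 - x)) = 1 - x) by (apply cos_acos; lra).
assert (Hb := acos_bound (1 - x)).
assert (Ht : 0 < acos (1 - x) <= PI / 2).
(* An angle [0] would force [x = 0]; an angle above [PI / 2] would make [1 - x] negative. *)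
{ split.
  - destruct (Req_dec (acos (1 - x)) 0) as [H0|]; [|lra].
    rewrite H0, cos_0 in Hcos; lra.
  - apply Rnot_lt_le; intros Hlt.
    assert (cos (acos (1 - x)) < 0) by (apply cos_lt_0; lra); lra. }
replace (f_real x) with (f_angle (acos (1 - x))); [now apply f_angle_neg|].
unfold f_real, f_angle.
(* The angle becomes [PI / 2 - asin (1 - x)], whose half supplies the [PI / 4]. *)
rewrite Hcos, sin_acos, acos_asin by lra.
replace (1 - (1 - x)) with x by ring.
replace (1 - (1 - x)²) with (2 * x - x ^ 2) by (unfold Rsqr; ring).
field.
apply Rgt_not_eq, sqrt_lt_R0; lra.
Qed.
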